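(* Let $A\in\mathbb{R}^{n\times n}$, and let $C_{ij}\in\mathbb{R}^{m_{ij}\times n}$ ($i,j\in\{1,\dots,q\}$) be matrices with $C_{ii}=0$. Assume: (1) $C_{ij}=C_{ji}$ for all $i,j$; (2) the graph $\mathcal{G}$ associated to $\{C_{ij}\}$ is connected; (3) $A$ is neutrally stable (in the continuous-time sense); (4) the pair $(C_{ij},A)$ is detectable (in the continuous-time sense) for all $i,j$ with $C_{ij}\neq0$. Let $n_1\le n$ be the number of eigenvalues of $A$ on the imaginary axis and $n_2:=n-n_1$. Define gains $G_{ij}\in\mathbb{R}^{n\times m_{ij}}$ as follows. If $n_1=0$, let $G_{ij}:=0$. Otherwise, choose any $U\in\mathbb{R}^{n\times n_1}$ and $W\in\mathbb{R}^{n\times n_2}$ such that $[U\ \ W]$ is invertible and $$[U\ \ W]^{-1}A[U\ \ W]=\begin{bmatrix}S&0\\0&F\end{bmatrix}$$ where $S\in\mathbb{R}^{n_1\times n_1}$ is skew-symmetric and $F\in\mathbb{R}^{n_2\times n_2}$ is stable, and let $G_{ij}:=UU^{T}C_{ij}^{T}$. Then the coupled systems $$\dot x_i=Ax_i+\sum_{j=1}^{q}G_{ij}C_{ij}(x_j-x_i),\qquad i=1,\dots,q,\quad x_i\in\mathbb{R}^n,$$ synchronize. Moreover, the solutions $x_i(t)$ remain bounded (for $t\ge 0$).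
   Context: The graph $\mathcal{G}$ associated to a set of matrices $\{C_{ij}\}$ has vertices $v_1,\dots,v_q$, and $(v_j,v_i)$ is an edge exactly when $C_{ij}\neq 0$; since $C_{ij}=C_{ji}$, the graph is undirected. Continuous-time definitions: $A$ is neutrally stable if it has no eigenvalue in the open right half-plane and, for each eigenvalue on the imaginary axis, the corresponding Jordan blocks are one-by-one. A matrix is stable if all its eigenvalues lie in the open left half-plane. $(C,A)$ is detectable if no eigenvector of $A$ with eigenvalue in the closed right half-plane belongs to the null space of $C$. Eigenvalues are counted with multiplicity. The systems are said to synchronize if $\|x_i(t)-x_j(t)\|\to0$ as $t\to\infty$ for all indices $i,j$ and all initial conditions. *)

(* Defs.v *)
From HB Require Import structures.
From mathcomp Require Import all_boot all_order all_algebra.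
From mathcomp Require Import all_classical all_reals all_analysis.
From mathcomp Require Import complex.

Set Implicit Arguments.
Unset Strict Implicit.
Unset Printing Implicit Defensive.

Import Order.TTheory GRing.Theory Num.Theory.
Import numFieldNormedType.Exports.

Local Open Scope classical_set_scope.
Local Open Scope ring_scope.

Definition complexify (R : realType) (m n : nat) (A : 'M[R]_(m, n)) :
    'M[R[i]]_(m, n) :=
  map_mx (fun r : R => r%:C%C) A.

(* The roots of the characteristic polynomial, repeated according to their
   algebraic multiplicity: char_poly (complexify A) is the product of the
   'X - z%:P for z in this sequence. *)
Definition eigenvalues (R : realType) (n : nat) (A : 'M[R]_n) : seq R[i] :=
  sval (closed_field_poly_normal (char_poly (complexify A))).

Definition num_imaginary_eigenvalues (R : realType) (n : nat) (A : 'M[R]_n) :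
    nat :=
  count (fun z : R[i] => complex.Re z == 0) (eigenvalues A).

Definition stable (R : realType) (n : nat) (A : 'M[R]_n) : Prop :=
  forall z : R[i], eigenvalue (complexify A) z -> complex.Re z < 0.

Definition jordan_block (K : fieldType) (k : nat) (z : K) : 'M[K]_k :=
  \matrix_(i < k, j < k) (if i == j then z else (i.+1 == j :> nat)%:R).

(* [P] and [Q] are mutually inverse; they are typed as rectangular matrices
   because the size \sum_b p b of the block-diagonal matrix is equal to n, but
   not syntactically so. *)
Definition mx_inverses (K : fieldType) (m n : nat)
    (P : 'M[K]_(m, n)) (Q : 'M[K]_(n, m)) : Prop :=
  P *m Q = 1%:M /\ Q *m P = 1%:M.

Definition jordan_form (K : fieldType) (n : nat) (A : 'M[K]_n)
    (s : nat) (p : 'I_s -> nat) (z : 'I_s -> K) : Prop :=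
  (forall b, (0 < p b)%N) /\
  exists (P : 'M[K]_(n, \sum_(b < s) p b)) (Q : 'M[K]_(\sum_(b < s) p b, n)),
    mx_inverses P Q /\
    Q *m A *m P = \mxdiag_(b < s) jordan_block (p b) (z b).

(* The Jordan form exists and is unique up to the order of the blocks, so it
   does not matter which one is exhibited. *)
Definition neutrally_stable (R : realType) (n : nat) (A : 'M[R]_n) : Prop :=
  (forall z : R[i], eigenvalue (complexify A) z -> ~ (0 < complex.Re z)) /\
  exists (s : nat) (p : 'I_s -> nat) (z : 'I_s -> R[i]),
    jordan_form (complexify A) p z /\
    forall b, complex.Re (z b) = 0 -> p b = 1%N.

(* Eigenvectors are column vectors here, whereas the library's eigenspaces
   consist of row vectors. *)
Definition detectable (R : realType) (m n : nat)
    (C : 'M[R]_(m, n)) (A : 'M[R]_n) : Prop :=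
  ~ exists (z : R[i]) (v : 'cV[R[i]]_n),
      [/\ v != 0, complexify A *m v = z *: v, 0 <= complex.Re z
        & complexify C *m v = 0].

(* Equality of matrices whose numbers of rows are not known beforehand to
   agree; it includes the equality of these numbers. *)
Definition eq_mx_rows (R : realType) (m m' n : nat)
    (C : 'M[R]_(m, n)) (C' : 'M[R]_(m', n)) : Prop :=
  exists e : m = m', castmx (e, erefl n) C = C'.

Definition coupling_edge (R : realType) (n q : nat) (m : 'I_q -> 'I_q -> nat)
    (C : forall i j : 'I_q, 'M[R]_(m i j, n)) : rel 'I_q :=
  fun j i => C i j != 0.

Definition graph_connected (T : finType) (e : rel T) : Prop :=
  forall u v : T, connect e u v.

Definition skew_stable_splitting (R : realType) (n n1 n2 : nat)
    (A : 'M[R]_n) (U : 'M[R]_(n, n1)) (W : 'M[R]_(n, n2)) : Prop :=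
  exists (V : 'M[R]_(n1 + n2, n)) (S : 'M[R]_n1) (F : 'M[R]_n2),
    [/\ mx_inverses (row_mx U W) V,
        V *m A *m row_mx U W = block_mx S 0 0 F,
        S^T = - S
      & stable F].

Definition synchronizing_gains (R : realType) (n q : nat)
    (m : 'I_q -> 'I_q -> nat) (A : 'M[R]_n)
    (C : forall i j : 'I_q, 'M[R]_(m i j, n))
    (G : forall i j : 'I_q, 'M[R]_(n, m i j)) : Prop :=
  let n1 := num_imaginary_eigenvalues A in
  let n2 := (n - n1)%N in
  (n1 = 0%N -> forall i j, G i j = 0) /\
  (n1 <> 0%N ->
    exists (U : 'M[R]_(n, n1)) (W : 'M[R]_(n, n2)),
      skew_stable_splitting A U W /\
      forall i j, G i j = U *m U^T *m (C i j)^T).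

Definition euclidean_norm (R : realType) (n : nat) (v : 'cV[R]_n) : R :=
  Num.sqrt (\sum_(k < n) v k 0 ^+ 2).

(* Forward solutions, from the initial conditions x i 0. The values of x at
   negative times are irrelevant, hence the one-sided condition at time 0. *)
Definition coupled_solution (R : realType) (n q : nat)
    (m : 'I_q -> 'I_q -> nat) (A : 'M[R]_n)
    (C : forall i j : 'I_q, 'M[R]_(m i j, n))
    (G : forall i j : 'I_q, 'M[R]_(n, m i j))
    (x : 'I_q -> R -> 'cV[R]_n) : Prop :=
  forall i : 'I_q,
    (x i t @[t --> 0^'+] --> x i 0) /\
    forall t : R, 0 < t ->
      is_derive t 1 (x i)
        (A *m x i t + \sum_(j < q) G i j *m C i j *m (x j t - x i t)).

Definition synchronize (R : realType) (n q : nat)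
    (m : 'I_q -> 'I_q -> nat) (A : 'M[R]_n)
    (C : forall i j : 'I_q, 'M[R]_(m i j, n))
    (G : forall i j : 'I_q, 'M[R]_(n, m i j)) : Prop :=
  forall x : 'I_q -> R -> 'cV[R]_n, coupled_solution A C G x ->
    forall i j : 'I_q,
      euclidean_norm (x i t - x j t) @[t --> +oo] --> (0 : R).

Definition bounded_solutions (R : realType) (n q : nat)
    (m : 'I_q -> 'I_q -> nat) (A : 'M[R]_n)
    (C : forall i j : 'I_q, 'M[R]_(m i j, n))
    (G : forall i j : 'I_q, 'M[R]_(n, m i j)) : Prop :=
  forall x : 'I_q -> R -> 'cV[R]_n, coupled_solution A C G x ->
    forall i : 'I_q, exists M : R,
      forall t : R, 0 <= t -> euclidean_norm (x i t) <= M.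

(* Main.v *)
Require Import Defs.
From HB Require Import structures.
From mathcomp Require Import all_boot all_order all_algebra.
From mathcomp Require Import all_classical all_reals all_analysis.
From mathcomp Require Import complex ring lra.

Set Implicit Arguments.
Unset Strict Implicit.
Unset Printing Implicit Defensive.

Import Order.TTheory GRing.Theory Num.Theory.
Import numFieldNormedType.Exports.

Local Open Scope classical_set_scope.
Local Open Scope ring_scope.

(** Write [gain i j] for U U^T C_ij^T C_ij. These matrices are symmetric in
    (i, j), so summing the q equations gives (sum x)' = A (sum x), and the
    scaled deviations e_i = q x_i - sum_j x_j satisfy a linear equation of
    their own. Since the e_i add up to zero, the term - sum_j e_j may be added
    to that equation:

      e_i' = A e_i + sum_j gain i j (e_j - e_i) - sum_j e_j.

    The point of the extra term is that this system, on all of R^(nq), is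
    stable ([deviation_map_eigen]), whereas without it every eigenvalue of A,
    imaginary ones included, belongs to a synchronous mode. Indeed, let (v_i)
    be an eigenvector for z with Re z >= 0, and s = sum_i v_i. Summing the
    equations gives A s = (z + q) s, hence s = 0 because A has no eigenvalue in
    the open right half-plane. As F is stable, v_i lies in the range of U, say
    v_i = U xi_i. In the coordinates xi_i the equation becomes
    z xi_i = S xi_i + U^T sum_j C_ij^T C_ij (v_j - v_i); its inner product with
    xi_i, summed over i, gives

      2 z sum_i |xi_i|^2
        = 2 sum_i <xi_i, S xi_i> - sum_ij |C_ij (v_j - v_i)|^2.

    S being skew, the first term on the right is purely imaginary; so the real
    parts force C_ij (v_j - v_i) = 0 for all i, j. The coupling then vanishes,
    each v_j - v_i is null or an eigenvector of A killed by C_ij, and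
    detectability makes v constant along edges. By connectedness v is constant,
    and it is zero because s = 0.

    A solution of a stable linear equation tends to zero
    ([stable_flow_cvg0]), for the following reason. If the matrix is B and its
    characteristic polynomial is prod_k (X - z_k), the functionals
    prod_(k < l) (B - z_k) p are, along a trajectory, a cascade of scalar
    equations u_l' = z_l u_l + u_(l+1) ending with 0 by the Cayley-Hamilton
    theorem, and each scalar equation with Re z_l < 0 passes convergence to
    zero from its input to its output ([forced_mode_cvg0]).

    Boundedness: x_i is recovered from e_i and sum x. In the splitting given
    by U and W, the stable part of sum x tends to zero and the skew part has
    constant Euclidean norm. This bounds x_i for large t, and continuity bounds
    it on the remaining compact interval.

    When A has no eigenvalue on the imaginary axis, it is itself stable and the
    zero gains are those of the splitting with an empty U and W = 1, so both
    cases are instances of [synchronize_and_bounded]. *)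

(** * Scalar differential inequalities *)

Lemma is_derive_nonincreasing (R : realType) (f df : R -> R) (a : R) :
    (forall t : R, a <= t -> is_derive t 1 f (df t)) ->
    (forall t : R, a <= t -> df t <= 0) ->
  forall t, a <= t -> f t <= f a.
Proof.
move=> fd df_le0 t le_at.
have fdv s : s \in `[a, t] -> derivable f s 1.
  by rewrite in_itv /= => /andP[las _]; have /@ex_derive := fd s las.
apply: (@ler0_derive1_le_cc R f a t) => //.
- by move=> s /subset_itv_oo_cc; exact: fdv.
- move=> s /subset_itv_oo_cc; rewrite in_itv /= => /andP[las _].
  by have ds := fd s las; rewrite derive1E derive_val; exact: df_le0.
- by apply: derivable_within_continuous => s; exact: fdv.
- by rewrite in_itv /= lexx le_at.
- by rewrite in_itv /= lexx le_at.
Qed.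

(** For e > 0, once h is below c e / 2, the quantity exp (c t) (E - e / 2) no
    longer increases, so E ends up below e. *)
Lemma dissipation_cvg0 (R : realType) (c : R) (E dE h : R -> R) :
    0 < c -> (forall t : R, 0 < t -> is_derive t 1 E (dE t)) ->
    (forall t : R, 0 < t -> dE t <= - c * E t + h t) ->
    (forall t : R, 0 <= E t) ->
  h t @[t --> +oo] --> 0 -> E t @[t --> +oo] --> 0.
Proof.
move=> c_gt0 Ed dE_le E_ge0 h0; apply/cvgrPdist_le => e e_gt0 /=.
have ce_gt0 : 0 < c * (e / 2) by rewrite mulr_gt0// divr_gt0.
move/cvgrPdist_le: h0 => /(_ _ ce_gt0)[T0 [_ hT0]].
pose T := Num.max 1 (T0 + 1).
have T_gt0 : 0 < T by rewrite lt_max ltr01.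
have hT t : T <= t -> h t <= c * (e / 2).
  rewrite ge_max => /andP[_ leTt].
  have := hT0 t; rewrite sub0r normrN => /(_ _)/(le_trans (ler_norm _)); apply.
  by apply: lt_le_trans leTt; rewrite ltrDl.
pose g t := expR (c * (t - T)) * (E t - e / 2).
have gd t : T <= t ->
    is_derive t 1 g (expR (c * (t - T)) * (c * (E t - e / 2) + dE t)).
  move=> leTt; have t_gt0 := lt_le_trans T_gt0 leTt.
  have dE_t := Ed t t_gt0.
  pose l s : R := c * (s - T).
  have lin : is_derive t 1 l c.
    have : is_derive t 1 (c \*: (id - cst T) : R -> R) (c *: (1 - 0)).
      by apply: is_deriveZ; apply: is_deriveB.
    by rewrite subr0 [c *: _]mulr1.
  have ed := @is_derive1_comp R expR l t _ _ (is_derive_expR _) lin.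
  have Eed : is_derive t 1 (E - cst (e / 2)) (dE t - 0) by apply: is_deriveB.
  have := is_deriveM ed Eed; rewrite subr0 => gd.
  apply: is_derive_eq gd _; rewrite /GRing.scale /=.
  rewrite (_ : (E - cst (e / 2)) t = E t - e / 2) //= -/(l t); ring.
have g_le t : T <= t -> g t <= g T.
  move: t; apply: (is_derive_nonincreasing gd) => t leTt.
  rewrite pmulr_rle0 ?expR_gt0//.
  have := dE_le t (lt_le_trans T_gt0 leTt); have := hT t leTt; lra.
(* From this time on, 1 + c (t - T) <= exp (c (t - T)) already absorbs g T. *)
exists (T + `|g T| / c / (e / 2)); split; first exact: num_real.
move=> t ltt; rewrite sub0r normrN ger0_norm//.
have e2_gt0 : 0 < e / 2 by rewrite divr_gt0.
have leTt : T <= t.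
  by apply: le_trans (ltW ltt); rewrite lerDl !divr_ge0// ltW.
have gTle : `|g T| <= expR (c * (t - T)) * (e / 2).
  apply: le_trans (_ : (1 + c * (t - T)) * (e / 2) <= _); last first.
    by rewrite ler_pM2r// expR_ge1Dx.
  rewrite -ler_pdivrMr// -lerBlDl; apply: le_trans (_ : `|g T| / (e / 2) <= _).
    by rewrite lerBlDl lerDr.
  have -> : `|g T| / (e / 2) = c * (`|g T| / c / (e / 2)).
    by field; rewrite !gt_eqF.
  by rewrite ler_pM2l// lerBrDl ltW.
have : expR (c * (t - T)) * (E t - e / 2) <= expR (c * (t - T)) * (e / 2).
  exact: le_trans (g_le t leTt) (le_trans (ler_norm _) gTle).
by rewrite ler_pM2l ?expR_gt0//; lra.
Qed.

Lemma sqr_cvg0_ge (R : realType) (E u : R -> R) :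
    (forall t, u t ^+ 2 <= E t) ->
  E t @[t --> +oo] --> 0 -> u t @[t --> +oo] --> 0.
Proof.
move=> uE E0; apply/norm_cvg0P.
have sE0 : Num.sqrt (E t) @[t --> +oo] --> 0.
  by rewrite -(@sqrtr0 R); apply: continuous_cvg => //; exact: sqrt_continuous.
apply: (squeeze_cvgr _ (cvg_cst 0) sE0); near=> t.
by rewrite normr_ge0 -sqrtr_sqr ler_wsqrtr.
Unshelve. all: by end_near.
Qed.

(** These are the real and imaginary parts of w' = z w + k with z = a + b i
    and Re z < 0. The energy |w|^2 satisfies
    (|w|^2)' <= a |w|^2 + |k|^2 / (- a) by Young's inequality. *)
Lemma forced_mode_cvg0 (R : realType) (a b : R) (u v f g : R -> R) :
    a < 0 ->
    (forall t : R, 0 < t -> is_derive t 1 u (a * u t - b * v t + f t)) ->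
    (forall t : R, 0 < t -> is_derive t 1 v (a * v t + b * u t + g t)) ->
    f t @[t --> +oo] --> 0 -> g t @[t --> +oo] --> 0 ->
  u t @[t --> +oo] --> 0 /\ v t @[t --> +oo] --> 0.
Proof.
move=> a_lt0 ud vd f0 g0.
pose E t := u t ^+ 2 + v t ^+ 2.
pose h t := (- a)^-1 * (f t ^+ 2 + g t ^+ 2).
have h0 : h t @[t --> +oo] --> 0.
  rewrite (_ : 0 = (- a)^-1 * (0 * 0 + 0 * 0)); last first.
    by rewrite !mulr0 addr0 mulr0.
  by apply: cvgM; [exact: cvg_cst | apply: cvgD; exact: cvgM].
suff E0 : E t @[t --> +oo] --> 0.
  by split; apply: sqr_cvg0_ge E0 => t; rewrite /E ?lerDl ?lerDr sqr_ge0.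
pose dE t := 2 * u t * (a * u t - b * v t + f t)
  + 2 * v t * (a * v t + b * u t + g t).
apply: (@dissipation_cvg0 _ (- a) E dE h) => //.
- by rewrite oppr_gt0.
- move=> t t_gt0; have ud_t := ud t t_gt0; have vd_t := vd t t_gt0.
  have := is_deriveD (is_deriveX 2 ud_t) (is_deriveX 2 vd_t).
  by move/is_derive_eq; apply; rewrite /dE /GRing.scale /= !expr1; ring.
- move=> t _; rewrite /dE /E /h -subr_ge0.
  set w := f t; set z := g t.
  (* Young's inequality, as a completed square. *)
  rewrite [X in 0 <= X](_ : _ = (- a)^-1 *
    ((a * u t + w) ^+ 2 + (a * v t + z) ^+ 2)); last by field; rewrite lt_eqF.
  by rewrite mulr_ge0 ?addr_ge0 ?sqr_ge0// invr_ge0 oppr_ge0 ltW.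
- by move=> t; rewrite /E addr_ge0 ?sqr_ge0.
Qed.

(** * Derivatives of matrix-valued functions *)

Lemma is_derive_mxP (R : realType) (m n : nat) (x : R -> 'M[R]_(m, n))
    (t : R) (d : 'M[R]_(m, n)) :
  is_derive t 1 x d <->
  (forall i j, is_derive t 1 (fun s => x s i j) (d i j)).
Proof.
split=> [xd i j | xd].
  have /derivable_mxP xdv : derivable x t 1 by exact: ex_derive.
  apply: DeriveDef; first exact: xdv.
  have <- : 'D_1 x t = d by exact: derive_val.
  by rewrite derive_mx ?mxE//; exact: ex_derive.
have xdv : derivable x t 1 by apply/derivable_mxP => i j; exact: ex_derive.
apply: DeriveDef => //; rewrite derive_mx//.
by apply/matrixP => i j; rewrite mxE derive_val.
Qed.

Lemma is_derive_linear (R : realType) (m n p r : nat)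
    (f : {linear 'M[R]_(m, n) -> 'M[R]_(p, r)}) (x : R -> 'M[R]_(m, n))
    (t : R) (d : 'M[R]_(m, n)) :
  is_derive t 1 x d -> is_derive t 1 (f \o x) (f d).
Proof.
move=> /is_derive_mxP xd; apply/is_derive_mxP => k l.
have fE X : f X k l = \sum_i \sum_j f (delta_mx i j) k l * X i j.
  rewrite {1}[X]matrix_sum_delta linear_sum summxE; apply: eq_bigr => i _.
  rewrite linear_sum summxE; apply: eq_bigr => j _.
  by rewrite linearZ mxE mulrC.
rewrite fE; under eq_fun do rewrite /= fE.
have : is_derive t 1
    (\sum_i \sum_j (f (delta_mx i j) k l \*: (fun s => x s i j : R)))
    (\sum_i \sum_j f (delta_mx i j) k l *: d i j).
  by apply: is_derive_sum => i; apply: is_derive_sum => j; apply: is_deriveZ.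
congr is_derive; apply/funext => s; rewrite fct_sumE.
by apply: eq_bigr => i _; rewrite fct_sumE.
Qed.

(** * Decay along a stable linear flow *)

Section StableFlow.
Variables (R : realType) (N : nat) (B : 'M[R]_N) (y : R -> 'rV[R]_N).
Hypothesis yd : forall t : R, 0 < t -> is_derive t 1 y (y t *m B).

Let re (p : 'cV[R[i]]_N) (t : R) : R := (y t *m map_mx (@complex.Re R) p) 0 0.
Let im (p : 'cV[R[i]]_N) (t : R) : R := (y t *m map_mx (@complex.Im R) p) 0 0.

(** The complex functional p of the trajectory tends to zero; its real and
    imaginary parts are kept apart because y is real. *)
Definition decays (p : 'cV[R[i]]_N) : Prop :=
  re p t @[t --> +oo] --> 0 /\ im p t @[t --> +oo] --> 0.

Lemma is_derive_functional (c : 'cV[R]_N) (t : R) : 0 < t ->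
  is_derive t 1 (fun s => (y s *m c) 0 0) ((y t *m (B *m c)) 0 0).
Proof.
move=> t_gt0; rewrite mulmxA.
have ydt := yd t_gt0.
by have /is_derive_mxP := is_derive_linear (mulmxr c) ydt.
Qed.

Lemma Re_mulmx_complexify (p : 'cV[R[i]]_N) :
  map_mx (@complex.Re R) (complexify B *m p) = B *m map_mx (@complex.Re R) p.
Proof.
apply/matrixP => i j; rewrite !mxE raddf_sum; apply: eq_bigr => k _.
by rewrite !mxE; case: (p k j) => a b /=; rewrite mul0r subr0.
Qed.

Lemma Im_mulmx_complexify (p : 'cV[R[i]]_N) :
  map_mx (@complex.Im R) (complexify B *m p) = B *m map_mx (@complex.Im R) p.
Proof.
apply/matrixP => i j; rewrite !mxE raddf_sum; apply: eq_bigr => k _.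
by rewrite !mxE; case: (p k j) => a b /=; rewrite mul0r addr0.
Qed.

Lemma Re_mx_scaleD (z : R[i]) (p r : 'cV[R[i]]_N) :
  map_mx (@complex.Re R) (z *: p + r) =
  complex.Re z *: map_mx (@complex.Re R) p
  - complex.Im z *: map_mx (@complex.Im R) p + map_mx (@complex.Re R) r.
Proof.
by apply/matrixP => i j; rewrite !mxE raddfD; case: z (p i j) => a b [c d].
Qed.

Lemma Im_mx_scaleD (z : R[i]) (p r : 'cV[R[i]]_N) :
  map_mx (@complex.Im R) (z *: p + r) =
  complex.Re z *: map_mx (@complex.Im R) p
  + complex.Im z *: map_mx (@complex.Re R) p + map_mx (@complex.Im R) r.
Proof.
by apply/matrixP => i j; rewrite !mxE raddfD; case: z (p i j) => a b [c d].
Qed.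

(** Along the flow, the functional p obeys a scalar equation with rate z driven
    by the functional (B - z) p. *)
Lemma decays_of_factor (z : R[i]) (p : 'cV[R[i]]_N) :
  complex.Re z < 0 -> decays ((complexify B - z%:M) *m p) -> decays p.
Proof.
move=> z_lt0 [re0 im0].
have split_p : complexify B *m p = z *: p + (complexify B - z%:M) *m p.
  by rewrite mulmxBl mul_scalar_mx addrC subrK.
apply: (forced_mode_cvg0 (a := complex.Re z) (b := complex.Im z) _ _ _ re0 im0).
- by [].
- move=> t t_gt0; apply: is_derive_eq (is_derive_functional _ t_gt0) _.
  rewrite -Re_mulmx_complexify split_p Re_mx_scaleD !mulmxDr mulmxN -!scalemxAr.
  by rewrite /re /im; do 3!move: (y t *m _) => ?; rewrite !mxE.
- move=> t t_gt0; apply: is_derive_eq (is_derive_functional _ t_gt0) _.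
  rewrite -Im_mulmx_complexify split_p Im_mx_scaleD !mulmxDr -!scalemxAr.
  by rewrite /re /im; do 3!move: (y t *m _) => ?; rewrite !mxE.
Qed.

Lemma decays_of_factors (s : seq R[i]) (p : 'cV[R[i]]_N) :
    (forall z, z \in s -> complex.Re z < 0) ->
  decays (foldr (fun z r => (complexify B - z%:M) *m r) p s) -> decays p.
Proof.
elim: s => //= z s IHs s_lt0 zs.
apply: IHs => [w ws|]; first by rewrite s_lt0// inE ws orbT.
exact: decays_of_factor (s_lt0 _ (mem_head _ _)) zs.
Qed.

Lemma decays0 : decays 0.
Proof.
split; apply: cvg_near_cst; apply: nearW => t.
  by rewrite /re map_mx0 mulmx0 mxE.
by rewrite /im map_mx0 mulmx0 mxE.
Qed.

End StableFlow.

Lemma foldr_factorsE (K : fieldType) (N : nat) (B : 'M[K]_N.+1) (s : seq K)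
    (p : 'cV[K]_N.+1) :
  foldr (fun z r => (B - z%:M) *m r) p s =
  horner_mx B (\prod_(z <- s) ('X - z%:P)) *m p.
Proof.
elim: s => [|z s IHs] /=; first by rewrite big_nil rmorph1 mul1mx.
by rewrite big_cons rmorphM /= IHs mulmxA rmorphB /= horner_mx_X horner_mx_C.
Qed.

(** By Cayley-Hamilton, applying every factor of the characteristic polynomial
    to a functional gives the zero functional; the factors are then removed
    one at a time. *)
Lemma stable_flow_cvg0 (R : realType) (N : nat) (B : 'M[R]_N)
    (y : R -> 'rV[R]_N) :
    stable B -> (forall t : R, 0 < t -> is_derive t 1 y (y t *m B)) ->
  forall k, y t 0 k @[t --> +oo] --> 0.
Proof.
case: N B y => [|N] B y B_stable yd k; first by case: k.
have [s charE] := closed_field_poly_normal (char_poly (complexify B)).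
rewrite (monicP (char_poly_monic _)) scale1r in charE.
have s_lt0 z : z \in s -> complex.Re z < 0.
  move=> zs; apply: B_stable.
  by rewrite eigenvalue_root_char charE root_prod_XsubC.
have : decays y (delta_mx k 0).
  apply: (decays_of_factors yd s_lt0).
  by rewrite foldr_factorsE -charE Cayley_Hamilton mul0mx; exact: decays0.
case=> re0 _; suff E : (fun t => y t 0 k) =
    (fun t => (y t *m map_mx (@complex.Re R) (delta_mx k 0 : 'cV_N.+1)) 0 0).
  by rewrite E.
apply/funext => t; rewrite mxE (bigD1 k)//= big1 ?addr0 => [|j jk].
  by rewrite !mxE !eqxx mulr1.
by rewrite !mxE (negPf jk) mulr0.
Qed.

(** * Boundedness and Euclidean norms along trajectories *)

Definition eventually_bounded (R : realType) (f : R -> R) : Prop :=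
  exists M : R, \forall t \near +oo, `|f t| <= M.

Lemma eventually_boundedD (R : realType) (f g : R -> R) :
    eventually_bounded f -> eventually_bounded g ->
  eventually_bounded (fun t => f t + g t).
Proof.
move=> [M fM] [M' gM']; exists (M + M'); near=> t.
by apply: le_trans (ler_normD _ _) _; apply: lerD; near: t.
Unshelve. all: by end_near.
Qed.

Lemma eventually_boundedZ (R : realType) (c : R) (f : R -> R) :
  eventually_bounded f -> eventually_bounded (fun t => c * f t).
Proof.
move=> [M fM]; exists (`|c| * M); near=> t.
by rewrite normrM ler_wpM2l//; near: t.
Unshelve. all: by end_near.
Qed.

Lemma eventually_bounded_sum (R : realType) (k : nat) (f : 'I_k -> R -> R) :
    (forall l, eventually_bounded (f l)) ->
  eventually_bounded (fun t => \sum_l f l t).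
Proof.
elim: k f => [|k IHk] f fb.
  by exists 0; apply: nearW => t; rewrite big_ord0 normr0.
under eq_fun do rewrite big_ord_recl.
by apply: eventually_boundedD => //; apply: IHk.
Qed.

Lemma cvg0_eventually_bounded (R : realType) (f : R -> R) :
  f t @[t --> +oo] --> 0 -> eventually_bounded f.
Proof.
move=> /cvgrPdist_le f0; exists 1; near=> t.
by rewrite -normrN -[- f t]sub0r; near: t; exact: f0.
Unshelve. all: by end_near.
Qed.

Lemma bounded_of_eventually_bounded (R : realType) (f df : R -> R) :
    f t @[t --> 0^'+] --> f 0 ->
    (forall t : R, 0 < t -> is_derive t 1 f (df t)) ->
    eventually_bounded f ->
  exists M : R, forall t : R, 0 <= t -> `|f t| <= M.
Proof.
move=> f0 fd [M [T0 [_ fM]]].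
pose T := Num.max 1 T0.
have T_gt0 : 0 < T by rewrite lt_max ltr01.
have f_cont t : 0 < t -> {for t, continuous f}.
  move=> t_gt0; have /@ex_derive := fd t t_gt0.
  by move=> /derivable1_diffP/differentiable_continuous.
have f_within : {within `[0, T], continuous f}.
  apply/(continuous_within_itvP f T_gt0); split=> //.
  - by move=> t; rewrite in_itv /= => /andP[t_gt0 _]; exact: f_cont.
  - by apply: cvg_at_left_filter; exact: f_cont.
have [a _ fa] := EVT_max (ltW T_gt0) f_within.
have [b _ fb] := EVT_min (ltW T_gt0) f_within.
exists (Num.max M (Num.max (f a) (- f b))) => t t_ge0.
have [leTt|ltTt] := leP t T.
  have tT : t \in `[0, T] by rewrite in_itv /= t_ge0.
  rewrite le_max; apply/orP; right; rewrite ler_norml le_max; apply/andP; split.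
    rewrite lerNl le_max; apply/orP; right; rewrite lerN2; exact: fb.
  by rewrite fa.
rewrite le_max fM//; apply: le_lt_trans ltTt; rewrite le_max lexx orbT//.
Qed.

Lemma sum_cvg0 (R : realType) (k : nat) (f : 'I_k -> R -> R) :
    (forall l, f l t @[t --> +oo] --> 0) ->
  \sum_l f l t @[t --> +oo] --> 0.
Proof.
elim: k f => [|k IHk] f f0.
  by under eq_fun do rewrite big_ord0; exact: cvg_cst.
under eq_fun do rewrite big_ord_recl.
have := cvgD (f0 ord0) (IHk _ (fun l => f0 (lift ord0 l))).
by rewrite addr0; apply.
Qed.

Lemma euclidean_norm_cvg0 (R : realType) (n : nat) (v : R -> 'cV[R]_n) :
    (forall k, v t k 0 @[t --> +oo] --> 0) ->
  euclidean_norm (v t) @[t --> +oo] --> 0.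
Proof.
move=> v0; rewrite -(@sqrtr0 R); apply: continuous_cvg.
  exact: sqrt_continuous.
apply: sum_cvg0 => k; have := cvgM (v0 k) (v0 k).
by rewrite mulr0; apply.
Qed.

Lemma euclidean_norm_le (R : realType) (n : nat) (v : 'cV[R]_n)
    (M : 'I_n -> R) :
    (forall k, `|v k 0| <= M k) ->
  euclidean_norm v <= Num.sqrt (\sum_k M k ^+ 2).
Proof.
move=> vM; apply: ler_wsqrtr; apply: ler_sum => k _.
by rewrite -real_normK ?num_real// lerXn2r// nnegrE// (le_trans _ (vM k)).
Qed.

(** * Spectra and the Hermitian product *)

(** Left and right eigenvectors have the same eigenvalues: A - z cannot be
    row-free if it kills a nonzero column. *)
Lemma eigenvalue_col (K : fieldType) (n : nat) (A : 'M[K]_n) (z : K)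
    (v : 'cV[K]_n) :
  v != 0 -> A *m v = z *: v -> eigenvalue A z.
Proof.
move=> v_neq0 Av; apply/negP => /eqP ker0.
have : row_free (A - z%:M) by rewrite -kermx_eq0; exact/eqP.
rewrite row_free_unit => /mulKmx /(_ v).
rewrite mulmxBl Av mul_scalar_mx subrr mulmx0 => v0.
by rewrite -v0 eqxx in v_neq0.
Qed.

Lemma stable_trmx (R : realType) (n : nat) (F : 'M[R]_n) :
  stable F -> stable F^T.
Proof.
move=> F_stable z /eigenvalueP[v vF v_neq0]; apply: F_stable.
apply: (eigenvalue_col (v := v^T)).
  by apply: contra v_neq0 => /eqP/(congr1 trmx); rewrite trmxK trmx0 => ->.
have := congr1 trmx vF; rewrite trmx_mul linearZ /= => <-.
by rewrite /complexify map_trmx trmxK.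
Qed.

Lemma skew_quadratic_eq0 (R : realType) (k : nat) (M : 'M[R]_k)
    (u : 'cV[R]_k) :
  M^T = - M -> (u^T *m M *m u) 0 0 = 0.
Proof.
move=> M_skew; have : (u^T *m M *m u)^T = - (u^T *m M *m u).
  by rewrite !trmx_mul trmxK M_skew mulNmx mulmxN mulmxA.
move=> /matrixP/(_ 0 0); rewrite mxE [RHS]mxE => /eqP.
by rewrite -addr_eq0 -mulr2n mulrn_eq0 /= => /eqP.
Qed.

Section HermitianProduct.
Variable R : realType.

Definition hdot (k : nat) (u v : 'cV[R[i]]_k) : R[i] :=
  ((map_mx conjc u)^T *m v) 0 0.

Lemma hdotE k (u v : 'cV[R[i]]_k) : hdot u v = \sum_l conjc (u l 0) * v l 0.
Proof. by rewrite /hdot mxE; apply: eq_bigr => l _; rewrite !mxE. Qed.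

Lemma hdotDr k (u v w : 'cV[R[i]]_k) : hdot u (v + w) = hdot u v + hdot u w.
Proof. by rewrite /hdot mulmxDr mxE. Qed.

Lemma hdot_sumr k (I : finType) (u : 'cV[R[i]]_k) (v : I -> 'cV[R[i]]_k) :
  hdot u (\sum_j v j) = \sum_j hdot u (v j).
Proof. by rewrite /hdot mulmx_sumr summxE. Qed.

Lemma hdotZr k (z : R[i]) (u v : 'cV[R[i]]_k) : hdot u (z *: v) = z * hdot u v.
Proof. by rewrite /hdot -scalemxAr mxE. Qed.

Lemma hdotNr k (u v : 'cV[R[i]]_k) : hdot u (- v) = - hdot u v.
Proof. by rewrite /hdot mulmxN mxE. Qed.

Lemma hdotBl k (u v w : 'cV[R[i]]_k) : hdot (u - v) w = hdot u w - hdot v w.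
Proof. by rewrite /hdot map_mxB linearB mulmxBl !mxE. Qed.

Lemma hdotC k (u v : 'cV[R[i]]_k) : conjc (hdot u v) = hdot v u.
Proof.
rewrite !hdotE rmorph_sum; apply: eq_bigr => l _.
by rewrite rmorphM /= conjcK mulrC.
Qed.

Lemma hdot_adjoint k l (M : 'M[R]_(k, l)) (u : 'cV[R[i]]_l) (v : 'cV[R[i]]_k) :
  hdot (complexify M *m u) v = hdot u (complexify M^T *m v).
Proof.
rewrite /hdot map_mxM trmx_mul mulmxA; congr ((_ *m _ *m _) 0 0).
apply/matrixP => i j; rewrite !mxE; exact: conjc_real.
Qed.

Lemma hdot_ge0 k (u : 'cV[R[i]]_k) : 0 <= hdot u u.
Proof. by rewrite hdotE sumr_ge0// => l _; rewrite mulrC mulcJ_ge0. Qed.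

Lemma hdot_eq0 k (u : 'cV[R[i]]_k) : hdot u u = 0 -> u = 0.
Proof.
rewrite hdotE => /eqP; rewrite psumr_eq0 => [/allP u0|l _]; last first.
  by rewrite mulrC mulcJ_ge0.
apply/matrixP => l o; rewrite ord1 mxE; apply/eqP.
have := u0 l (mem_index_enum l); rewrite mulf_eq0 conjc_eq0.
by case/orP.
Qed.

Lemma conjc_ge0 (z : R[i]) : 0 <= z -> conjc z = z.
Proof.
by case: z => a b; rewrite lecE /= => /andP[/eqP -> _]; rewrite oppr0.
Qed.

Lemma hdot_skew k (S : 'M[R]_k) (u : 'cV[R[i]]_k) : S^T = - S ->
  conjc (hdot u (complexify S *m u)) = - hdot u (complexify S *m u).
Proof.
move=> S_skew; rewrite hdotC hdot_adjoint S_skew.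
by rewrite /complexify map_mxN mulNmx hdotNr.
Qed.

End HermitianProduct.

(** * The coupling operator and the deviations *)

(** The column X_i is the state of the system i. *)
Definition coupling (K : nzRingType) (n q : nat) (D : 'I_q -> 'I_q -> 'M[K]_n)
    (X : 'M[K]_(n, q)) : 'M[K]_(n, q) :=
  \matrix_(k, i) (\sum_j D i j *m (col j X - col i X)) k 0.

(** The product with the all-ones matrix replaces every column by the sum of all
    columns. It vanishes on deviations, and it damps the synchronous
    directions. *)
Definition deviation_map (K : nzRingType) (n q : nat) (A : 'M[K]_n)
    (D : 'I_q -> 'I_q -> 'M[K]_n) (X : 'M[K]_(n, q)) : 'M[K]_(n, q) :=
  A *m X + coupling D X - X *m const_mx 1.

Lemma eq_cols (K : Type) (m n : nat) (X Y : 'M[K]_(m, n)) :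
  (forall j, col j X = col j Y) -> X = Y.
Proof.
move=> XY; apply/matrixP => i j.
by have /colP/(_ i) := XY j; rewrite !mxE.
Qed.

Lemma col_coupling (K : nzRingType) (n q : nat) (D : 'I_q -> 'I_q -> 'M[K]_n)
    (X : 'M[K]_(n, q)) (i : 'I_q) :
  col i (coupling D X) = \sum_j D i j *m (col j X - col i X).
Proof. by apply/colP => k; rewrite !mxE. Qed.

Lemma deviation_map_is_linear (K : comNzRingType) (n q : nat) (A : 'M[K]_n)
  (D : 'I_q -> 'I_q -> 'M[K]_n) : linear (@deviation_map K n q A D).
Proof.
move=> a X Y; rewrite /deviation_map.
have -> : coupling D (a *: X + Y) = a *: coupling D X + coupling D Y.
  apply: eq_cols => i; rewrite [RHS]linearP /= !col_coupling scaler_sumr.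
  rewrite -big_split; apply: eq_bigr => j _ /=.
  rewrite ![col _ (_ + _)]linearP /= opprD addrACA -scalerBr.
  by rewrite mulmxDr -scalemxAr.
rewrite mulmxDr mulmxDl -scalemxAr -scalemxAl !scalerDr opprD scalerN.
by rewrite (addrACA (a *: (A *m X))); exact: addrACA.
Qed.

HB.instance Definition _ (K : comNzRingType) (n q : nat) (A : 'M[K]_n)
    (D : 'I_q -> 'I_q -> 'M[K]_n) :=
  GRing.isLinear.Build K 'M[K]_(n, q) 'M[K]_(n, q) _ (deviation_map A D)
    (deviation_map_is_linear A D).

Lemma complexify_deviation_map (R : realType) (n q : nat) (A : 'M[R]_n)
    (D : 'I_q -> 'I_q -> 'M[R]_n) (X : 'M[R]_(n, q)) :
  complexify (deviation_map A D X) =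
  deviation_map (complexify A) (fun i j => complexify (D i j)) (complexify X).
Proof.
rewrite /deviation_map /complexify map_mxB map_mxD !map_mxM.
rewrite map_const_mx rmorph1.
congr (_ + _ - _); apply: eq_cols => i.
rewrite -map_col !col_coupling map_mx_sum; apply: eq_bigr => j _.
by rewrite map_mxM map_mxB !map_col.
Qed.

Lemma gram_sym (R : realType) (m m' n : nat) (C : 'M[R]_(m, n))
    (C' : 'M[R]_(m', n)) :
  eq_mx_rows C C' -> C^T *m C = C'^T *m C'.
Proof. by case=> e; case: _ / e C' => C'; rewrite castmx_id => ->. Qed.

(** Exchange i and j and add: v_i and v_j occur with opposite signs, which
    turns the inner products with v_i into squares. *)
Lemma coupling_energy (R : realType) (n q : nat)
    (M : 'I_q -> 'I_q -> 'M[R[i]]_n) (v : 'I_q -> 'cV[R[i]]_n) :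
    (forall i j, M i j = M j i) ->
  (\sum_i \sum_j hdot (v i) (M i j *m (v j - v i))) *+ 2 =
  - \sum_i \sum_j hdot (v j - v i) (M i j *m (v j - v i)).
Proof.
move=> M_sym; rewrite mulr2n {2}exchange_big -big_split -sumrN.
apply: eq_bigr => i _; rewrite -big_split -sumrN; apply: eq_bigr => j _ /=.
by rewrite M_sym hdotBl -(opprB (v j)) mulmxN hdotNr -M_sym opprB addrC.
Qed.

Lemma sum_coupling (K : nzRingType) (n q : nat) (D : 'I_q -> 'I_q -> 'M[K]_n)
    (v : 'I_q -> 'cV[K]_n) : (forall i j, D i j = D j i) ->
  \sum_i \sum_j D i j *m (v j - v i) = 0.
Proof.
move=> D_sym.
under eq_bigr do under eq_bigr do rewrite mulmxBr.
under eq_bigr do rewrite sumrB; rewrite sumrB {1}exchange_big /=.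
apply/eqP; rewrite subr_eq0; apply/eqP; apply: eq_bigr => i _.
by apply: eq_bigr => j _; rewrite D_sym.
Qed.

(** This is q times the projection along the all-ones vector: it turns the
    columns x_i into q x_i - sum_j x_j. The factor q avoids divisions. *)
Definition deviation_mx (K : nzRingType) (q : nat) : 'M[K]_q :=
  q%:R%:M - const_mx 1.

Lemma deviation_mxE (K : comNzRingType) (n q : nat) (X : 'M[K]_(n, q)) k i :
  (X *m deviation_mx K q) k i = q%:R * X k i - \sum_j X k j.
Proof.
rewrite mulmxBr mul_mx_scalar !mxE; congr (_ - _).
by apply: eq_bigr => j _; rewrite mxE mulr1.
Qed.

Lemma deviation_mx_ones (K : comNzRingType) (q p : nat) :
  deviation_mx K q *m const_mx 1 = 0 :> 'M[K]_(q, p).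
Proof.
apply/matrixP => i j; rewrite mulmxBl mul_scalar_mx !mxE mulr1.
under eq_bigr do rewrite !mxE mulr1.
by rewrite sumr_const card_ord subrr.
Qed.

Lemma coupling_ones (K : nzRingType) (n q p : nat) (D : 'I_q -> 'I_q -> 'M[K]_n)
    (X : 'M[K]_(n, q)) : (forall i j, D i j = D j i) ->
  coupling D X *m const_mx 1 = 0 :> 'M[K]_(n, p).
Proof.
move=> D_sym; apply/matrixP => k l.
have /colP/(_ k) sum0 := sum_coupling (fun i => col i X) D_sym.
rewrite summxE [RHS]mxE in sum0; rewrite mxE [RHS]mxE -[RHS]sum0.
by apply: eq_bigr => i _; rewrite mxE [const_mx _ _ _]mxE mulr1.
Qed.

Lemma coupling_deviation (K : comNzRingType) (n q : nat)
    (D : 'I_q -> 'I_q -> 'M[K]_n) (X : 'M[K]_(n, q)) :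
    (forall i j, D i j = D j i) ->
  coupling D (X *m deviation_mx K q) = coupling D X *m deviation_mx K q.
Proof.
move=> D_sym; rewrite [RHS]mulmxBr coupling_ones// subr0 mul_mx_scalar.
apply: eq_cols => i; rewrite linearZ /= !col_coupling scaler_sumr.
apply: eq_bigr => j _; rewrite scalemxAr; congr (_ *m _).
apply/colP => k.
have colX l : col l (X *m deviation_mx K q) k 0 = q%:R * X k l - \sum_j X k j.
  by rewrite mxE deviation_mxE.
move: (colX i) (colX j); move: (col i (X *m _)) (col j (X *m _)) => u v ui vj.
by rewrite !mxE ui vj; ring.
Qed.

(** The deviations evolve by [deviation_map] when the states evolve by
    x_i' = A x_i + sum_j D_ij (x_j - x_i). *)
Lemma deviation_mapE (K : comNzRingType) (n q : nat) (A : 'M[K]_n)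
    (D : 'I_q -> 'I_q -> 'M[K]_n) (X : 'M[K]_(n, q)) :
    (forall i j, D i j = D j i) ->
  deviation_map A D (X *m deviation_mx K q) =
  (A *m X + coupling D X) *m deviation_mx K q.
Proof.
move=> D_sym; rewrite /deviation_map coupling_deviation//.
by rewrite -(mulmxA X) deviation_mx_ones mulmx0 subr0 mulmxDl mulmxA.
Qed.

(** * The spectrum of the deviation dynamics *)

Section DeviationSpectrum.
Variables (R : realType) (n n1 n2 q : nat) (m : 'I_q -> 'I_q -> nat).
Variables (A : 'M[R]_n) (C : forall i j : 'I_q, 'M[R]_(m i j, n)).
(* V1 and V2 are the upper and lower row blocks of the inverse of [U W]. *)
Variables (U : 'M[R]_(n, n1)) (W : 'M[R]_(n, n2)).
Variables (V1 : 'M[R]_(n1, n)) (V2 : 'M[R]_(n2, n)).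
Variables (S : 'M[R]_n1) (F : 'M[R]_n2).
Hypothesis V1U : V1 *m U = 1%:M.
Hypothesis V2U : V2 *m U = 0.
Hypothesis UVWV : U *m V1 + W *m V2 = 1%:M.
Hypothesis V1A : V1 *m A = S *m V1.
Hypothesis V2A : V2 *m A = F *m V2.
Hypothesis S_skew : S^T = - S.
Hypothesis F_stable : stable F.
Hypothesis A_le0 :
  forall z : R[i], eigenvalue (complexify A) z -> ~ (0 < complex.Re z).
Hypothesis C_sym : forall i j, eq_mx_rows (C i j) (C j i).
Hypothesis C_conn : graph_connected (coupling_edge C).
Hypothesis CA_detect : forall i j, C i j != 0 -> detectable (C i j) A.

Local Notation cx := complexify.

Definition gram (i j : 'I_q) : 'M[R]_n := (C i j)^T *m C i j.
Definition gain (i j : 'I_q) : 'M[R]_n := U *m U^T *m gram i j.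

Lemma gram_symm i j : gram i j = gram j i.
Proof. exact: gram_sym. Qed.

Lemma gain_symm i j : gain i j = gain j i.
Proof. by rewrite /gain gram_symm. Qed.

(** The modes of the original network in the closed right half-plane are
    synchronous: the energy identity forces every C_ij (v_j - v_i) to vanish,
    and then detectability and connectedness apply. *)
Lemma synchronous_of_closed_rhp (z : R[i]) (v : 'I_q -> 'cV[R[i]]_n) :
    0 <= complex.Re z ->
    (forall i, cx A *m v i + \sum_j cx (gain i j) *m (v j - v i) = z *: v i) ->
  forall i j, v i = v j.
Proof.
move=> z_ge0 v_eig.
have cxM k l p (M : 'M[R]_(k, l)) (M' : 'M[R]_(l, p)) :
  cx (M *m M') = cx M *m cx M' by exact: map_mxM.
(* Otherwise V2 v_i would be an eigenvector of F for z. *)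
have V2v i : cx V2 *m v i = 0.
  apply/eqP; apply: contraTT z_ge0 => V2v_neq0; rewrite -ltNge.
  apply: F_stable; apply: (eigenvalue_col V2v_neq0).
  rewrite scalemxAr -v_eig mulmxDr !mulmxA -!cxM V2A mulmx_sumr.
  rewrite big1 ?addr0// => j _.
  by rewrite mulmxA -cxM /gain !mulmxA V2U !mul0mx /complexify map_mx0 mul0mx.
have UV1v i : cx U *m (cx V1 *m v i) = v i.
  have cx1 : cx (1%:M : 'M[R]_n) = 1%:M by exact: map_mx1.
  rewrite -[RHS]mul1mx -cx1 -UVWV /complexify map_mxD !map_mxM mulmxDl.
  by rewrite -!mulmxA V2v mulmx0 addr0.
pose xi i := cx V1 *m v i.
have xi_eig i : z *: xi i =
    cx S *m xi i + \sum_j cx U^T *m (cx (gram i j) *m (v j - v i)).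
  rewrite /xi scalemxAr -v_eig mulmxDr !mulmxA -!cxM V1A mulmx_sumr.
  congr (_ + _); apply: eq_bigr => j _.
  by rewrite !mulmxA -!cxM /gain !mulmxA V1U mul1mx.
have energy i : z * hdot (xi i) (xi i) = hdot (xi i) (cx S *m xi i) +
    \sum_j hdot (v i) (cx (gram i j) *m (v j - v i)).
  rewrite -hdotZr xi_eig hdotDr hdot_sumr; congr (_ + _).
  by apply: eq_bigr => j _; rewrite -hdot_adjoint UV1v.
pose N := \sum_i hdot (xi i) (xi i).
pose T := \sum_i hdot (xi i) (cx S *m xi i).
pose w i j := cx (C i j) *m (v j - v i).
pose Q := \sum_i \sum_j hdot (w i j) (w i j).
have N_ge0 : 0 <= N by apply: sumr_ge0 => i _; exact: hdot_ge0.
have Q_ge0 : 0 <= Q.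
  by apply: sumr_ge0 => i _; apply: sumr_ge0 => j _; exact: hdot_ge0.
have TJ : conjc T = - T.
  by rewrite rmorph_sum -sumrN; apply: eq_bigr => i _; exact: hdot_skew.
have NQ : (z * N) *+ 2 = T *+ 2 - Q.
  rewrite mulr_sumr (eq_bigr _ (fun i _ => energy i)) big_split mulrnDl /=.
  rewrite coupling_energy => [|i j]; last by rewrite gram_symm.
  congr (_ - _); apply: eq_bigr => i _; apply: eq_bigr => j _.
  by rewrite /w hdot_adjoint mulmxA -cxM.
(* Adding its conjugate to the identity NQ removes T, which is imaginary, and
   leaves 2 Re z N = - Q, a nonnegative number equal to a nonpositive one. *)
have Q0 : Q = 0.
  have ReNQ : (z + conjc z) * N *+ 2 = - Q *+ 2.
    rewrite mulrDl mulrnDl NQ.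
    have := congr1 (@conjc R) NQ.
    rewrite rmorphMn rmorphM rmorphB rmorphMn /= TJ.
    by rewrite (conjc_ge0 N_ge0) (conjc_ge0 Q_ge0) => ->; ring.
  apply/eqP; rewrite eq_le Q_ge0 andbT -oppr_ge0 -(pmulrn_lge0 _ (n := 2))//.
  by rewrite -ReNQ pmulrn_lge0// mulr_ge0// addcJ mulr_ge0// lecR.
have w0 i j : w i j = 0.
  apply: hdot_eq0; apply/eqP; move/eqP: Q0.
  rewrite psumr_eq0 => [/allP|k _]; last first.
    by apply: sumr_ge0 => l _; exact: hdot_ge0.
  move/(_ i (mem_index_enum i)).
  rewrite psumr_eq0 => [/allP/(_ j (mem_index_enum j))//|k _].
  exact: hdot_ge0.
have v_free i : cx A *m v i = z *: v i.
  rewrite -v_eig big1 ?addr0// => j _.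
  by rewrite /gain /gram !cxM -!mulmxA -/(w i j) w0 !mulmx0.
have edge_eq i j : coupling_edge C j i -> v j = v i.
  move=> Cij; apply/eqP; rewrite -subr_eq0; apply/negPn/negP => vij_neq0.
  apply: (CA_detect Cij); exists z, (v j - v i); split=> //.
  by rewrite mulmxBr !v_free scalerBr.
move=> i j; have /connectP[p] := C_conn i j.
elim: p i => [|k p IHp] i /=; first by move=> _ ->.
by case/andP=> ik pk jE; rewrite (edge_eq _ _ ik); exact: IHp.
Qed.

(** For an eigenvalue in the closed right half-plane, the sum s of the columns
    of the eigenvector satisfies A s = (z + q) s, hence s = 0; the columns then
    form a mode of the original network. *)
Lemma deviation_map_eigen (z : R[i]) (Y : 'M[R[i]]_(n, q)) : Y != 0 ->
    deviation_map (cx A) (fun i j => cx (gain i j)) Y = z *: Y ->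
  complex.Re z < 0.
Proof.
move=> Y_neq0 YE; rewrite ltNge; apply/negP => z_ge0.
pose v i := col i Y; pose s := \sum_j v j.
have v_eig i :
    cx A *m v i + \sum_j cx (gain i j) *m (v j - v i) - s = z *: v i.
  have <- :
      col i (deviation_map (cx A) (fun i j => cx (gain i j)) Y) = z *: v i.
    by rewrite YE linearZ.
  rewrite /deviation_map [RHS]raddfB /= [col i (_ + _)]raddfD /= col_coupling.
  rewrite -/(v i) [col i (cx A *m Y)]colE -mulmxA -colE.
  congr (_ + _ - _); apply/colP => k; rewrite !mxE summxE.
  by apply: eq_bigr => j _; rewrite !mxE mulr1.
have [s0|s_neq0] := eqVneq s 0.
  have v_const : forall i j, v i = v j.
    apply: (synchronous_of_closed_rhp z_ge0) => i.
    by rewrite -v_eig s0 subr0.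
  case/eqP: Y_neq0; apply: eq_cols => i; rewrite -/(v i) col0.
  have /eqP := s0; rewrite /s (eq_bigr (fun=> v i)) => [|j _]; last first.
    exact: v_const.
  rewrite sumr_const card_ord -scaler_nat scaler_eq0 pnatr_eq0.
  by rewrite gtn_eqF ?(leq_ltn_trans _ (ltn_ord i))//= => /eqP.
have s_eig : cx A *m s = (z + q%:R) *: s.
  have : \sum_i (cx A *m v i + \sum_j cx (gain i j) *m (v j - v i) - s) =
      \sum_i z *: v i by apply: eq_bigr => i _; exact: v_eig.
  rewrite sumrB big_split /= sum_coupling => [|i j]; last by rewrite gain_symm.
  rewrite -mulmx_sumr addr0 sumr_const card_ord -scaler_sumr => /eqP.
  by rewrite subr_eq scalerDl scaler_nat => /eqP.
apply: (A_le0 (eigenvalue_col s_neq0 s_eig)).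
have q_gt0 : (0 < q)%N.
  rewrite lt0n; apply: contra s_neq0 => /eqP q0; rewrite /s big1// => i.
  by have := ltn_ord i; rewrite {2}q0.
rewrite raddfD /= (_ : (q%:R : R[i]) = (q%:R : R)%:C%C); last first.
  by rewrite rmorph_nat.
by rewrite ltr_wpDl ?ltr0n.
Qed.

Lemma lin_deviation_map_stable : stable (lin_mx (@deviation_map R n q A gain)).
Proof.
move=> z; rewrite /complexify (map_lin_mx (complexify_deviation_map A gain)).
move=> /eigenvalueP[y]; rewrite mul_rV_lin => /(congr1 vec_mx) yE y_neq0.
rewrite mxvecK linearZ /= in yE.
apply: deviation_map_eigen yE.
by apply: contra y_neq0 => /eqP y0; rewrite -(vec_mxK y) y0 linear0.
Qed.

(** * Trajectories of the coupled systems *)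

Section Trajectories.
Variables (G : forall i j : 'I_q, 'M[R]_(n, m i j)) (x : 'I_q -> R -> 'cV[R]_n).
Hypothesis GE : forall i j, G i j = U *m U^T *m (C i j)^T.
Hypothesis x_sol : coupled_solution A C G x.

Let X (t : R) : 'M[R]_(n, q) := \matrix_(k, i) x i t k 0.

Let gains_gramE i j : G i j *m C i j = gain i j.
Proof. by rewrite GE /gain /gram [RHS]mulmxA. Qed.

Lemma trajectory_derive (t : R) :
  0 < t -> is_derive t 1 X (A *m X t + coupling gain (X t)).
Proof.
have colX i : col i (X t) = x i t by apply/colP => k; rewrite !mxE.
move=> t_gt0; apply/is_derive_mxP => k i.
have /is_derive_mxP/(_ k 0) := (x_sol i).2 t t_gt0.
under eq_bigr do rewrite gains_gramE.
suff -> : (fun s => X s k i) = (fun s => x i s k 0).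
  suff -> : (A *m X t + coupling gain (X t)) k i =
      (A *m x i t + \sum_(j < q) gain i j *m (x j t - x i t)) k 0 by [].
  transitivity (col i (A *m X t + coupling gain (X t)) k 0).
    exact/esym/mxE.
  rewrite raddfD /= col_coupling colE -mulmxA -colE colX.
  by congr (fun_of_matrix (_ + _) k 0); apply: eq_bigr => j _; rewrite !colX.
by apply/funext => s; rewrite mxE.
Qed.

Let E (t : R) : 'M[R]_(n, q) := X t *m deviation_mx R q.

Lemma deviation_cvg0 k i : E t k i @[t --> +oo] --> 0.
Proof.
have yd (t : R) : 0 < t -> is_derive t 1 (mxvec \o E)
    ((mxvec \o E) t *m lin_mx (deviation_map A gain)).
  move=> t_gt0; rewrite mul_rV_lin /= mxvecK deviation_mapE; last first.
    exact: gain_symm.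
  apply: (is_derive_linear mxvec).
  apply: (is_derive_linear (mulmxr (deviation_mx R q))).
  exact: trajectory_derive.
have := stable_flow_cvg0 lin_deviation_map_stable yd (mxvec_index k i).
by under eq_fun do rewrite /= mxvecE.
Qed.

Lemma difference_cvg0 i j k : (x i t - x j t) k 0 @[t --> +oo] --> 0.
Proof.
have q_neq0 : q%:R != 0 :> R.
  by rewrite pnatr_eq0 gtn_eqF// (leq_ltn_trans _ (ltn_ord i)).
have := cvgM (cvg_cst (q%:R^-1 : R))
  (cvgB (deviation_cvg0 k i) (deviation_cvg0 k j)).
rewrite subr0 mulr0 => /(_ _ _ _).
suff -> : (fun t => (x i t - x j t) k 0) =
    (fun t => q%:R^-1 * (E t k i - E t k j)).
  by apply.
apply/funext => t; rewrite !deviation_mxE !mxE; set s := \sum_(_ < _) _.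
by rewrite opprB addrA subrK -mulrBr mulKf.
Qed.

Let total (t : R) : 'cV[R]_n := X t *m const_mx 1.

(** The coupling terms cancel in the sum of the states. *)
Lemma total_derive (t : R) : 0 < t -> is_derive t 1 total (A *m total t).
Proof.
move=> t_gt0; have := is_derive_linear (mulmxr (const_mx 1 : 'cV[R]_q))
  (trajectory_derive t_gt0).
by rewrite /= mulmxDl coupling_ones ?addr0 ?mulmxA//; exact: gain_symm.
Qed.

Lemma stable_part_cvg0 k : (V2 *m total t) k 0 @[t --> +oo] --> 0.
Proof.
pose y (t : R) : 'rV[R]_n2 := (V2 *m total t)^T.
have yd (t : R) : 0 < t -> is_derive t 1 y (y t *m F^T).
  move=> t_gt0; rewrite -trmx_mul mulmxA -V2A -mulmxA.
  apply: (is_derive_linear trmx).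
  exact: (is_derive_linear (mulmx V2) (total_derive t_gt0)).
have := stable_flow_cvg0 (stable_trmx F_stable) yd k.
by under eq_fun do rewrite mxE.
Qed.

(** The derivative of the squared norm is twice a skew quadratic form. *)
Lemma skew_part_bounded k : eventually_bounded (fun t => (V1 *m total t) k 0).
Proof.
pose xi (t : R) := V1 *m total t.
have xid (t : R) : 0 < t -> is_derive t 1 xi (S *m xi t).
  move=> t_gt0; rewrite mulmxA -V1A -mulmxA.
  exact: (is_derive_linear (mulmx V1) (total_derive t_gt0)).
pose N : R -> R := \sum_l (fun t => xi t l 0) ^+ 2.
have NE t : N t = \sum_l xi t l 0 ^+ 2 by rewrite /N fct_sumE.
have Nd (t : R) : 1 <= t -> is_derive t 1 N 0.
  move=> t_ge1; have t_gt0 : 0 < t by apply: lt_le_trans t_ge1.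
  have /is_derive_mxP xidt := xid t t_gt0.
  apply: (is_derive_eq (is_derive_sum (fun l => is_deriveX 2 (xidt l 0)))).
  have := skew_quadratic_eq0 (xi t) S_skew; rewrite -mulmxA mxE => skew0.
  transitivity (2 * \sum_l (xi t)^T 0 l * (S *m xi t) l 0).
    rewrite mulr_sumr; apply: eq_bigr => l _.
    by rewrite [_^T 0 l]mxE expr1 mulrA.
  by rewrite skew0 mulr0.
exists (Num.sqrt (N 1)); near=> t.
rewrite -sqrtr_sqr; apply: ler_wsqrtr.
have t_ge1 : 1 <= t by near: t; exact: nbhs_pinfty_ge.
apply: le_trans (is_derive_nonincreasing Nd (fun _ _ => lexx 0) t_ge1).
by rewrite NE (bigD1 k)//= lerDl sumr_ge0// => l _; rewrite sqr_ge0.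
Unshelve. all: by end_near.
Qed.

(** The state x_i is the sum of its scaled deviation and of the two parts of
    the total state, divided by q. *)
Lemma trajectory_eventually_bounded i k :
  eventually_bounded (fun t => x i t k 0).
Proof.
have q_neq0 : q%:R != 0 :> R.
  by rewrite pnatr_eq0 gtn_eqF// (leq_ltn_trans _ (ltn_ord i)).
suff -> : (fun t => x i t k 0) = (fun t => q%:R^-1 * (E t k i +
    (\sum_l U k l * (V1 *m total t) l 0 + \sum_l W k l * (V2 *m total t) l 0))).
  apply: eventually_boundedZ; apply: eventually_boundedD.
    exact/cvg0_eventually_bounded/deviation_cvg0.
  apply: eventually_boundedD; apply: eventually_bounded_sum => l.
    exact/eventually_boundedZ/skew_part_bounded.
  exact/eventually_boundedZ/cvg0_eventually_bounded/stable_part_cvg0.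
apply/funext => t.
have totalE : \sum_j X t k j =
    (U *m (V1 *m total t) + W *m (V2 *m total t)) k 0.
  rewrite (mulmxA U) (mulmxA W) -mulmxDl UVWV mul1mx mxE.
  by apply: eq_bigr => j _; rewrite [const_mx _ _ _]mxE mulr1.
rewrite deviation_mxE totalE; move: (V1 *m _) (V2 *m _) => v1 v2.
rewrite [X in _ - X](_ : _ =
    \sum_l U k l * v1 l 0 + \sum_l W k l * v2 l 0); last by rewrite !mxE.
by rewrite subrK mulKf// mxE.
Qed.

Lemma trajectory_bounded i : exists M : R,
  forall t : R, 0 <= t -> euclidean_norm (x i t) <= M.
Proof.
have /choice[M xM] k : exists M : R, forall t : R, 0 <= t -> `|x i t k 0| <= M.
  have [x0 xd] := x_sol i.
  apply: bounded_of_eventually_bounded (trajectory_eventually_bounded i k).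
    exact: (cvg_comp _ _ x0 (@coord_continuous _ _ _ k 0 _)).
  by move=> t t_gt0; have /is_derive_mxP/(_ k 0) := xd t t_gt0.
exists (Num.sqrt (\sum_k M k ^+ 2)) => t t_ge0.
by apply: euclidean_norm_le => k; exact: xM.
Qed.

End Trajectories.

Lemma synchronize_and_bounded
    (G : forall i j : 'I_q, 'M[R]_(n, m i j)) :
    (forall i j, G i j = U *m U^T *m (C i j)^T) ->
  synchronize A C G /\ bounded_solutions A C G.
Proof.
move=> GE; split=> x x_sol; last exact: trajectory_bounded x_sol.
move=> i j; apply: euclidean_norm_cvg0 => k.
exact: (difference_cvg0 GE x_sol).
Qed.

End DeviationSpectrum.

Lemma stable_of_no_imaginary_eigenvalue (R : realType) (n : nat) (A : 'M[R]_n) :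
    neutrally_stable A -> num_imaginary_eigenvalues A = 0%N ->
  stable A.
Proof.
move=> [A_le0 _] /eqP; rewrite eqn0Ngt -has_count => /hasPn A_neq0 z z_eig.
rewrite lt_neqAle leNgt; apply/andP; split; last exact/negP/A_le0.
apply: A_neq0; rewrite /eigenvalues.
case: closed_field_poly_normal => s /= charE.
rewrite eigenvalue_root_char charE in z_eig.
rewrite (monicP (char_poly_monic _)) scale1r in z_eig.
by rewrite root_prod_XsubC in z_eig.
Qed.

Theorem theorem2 (R : realType) (n q : nat) (m : 'I_q -> 'I_q -> nat)
    (A : 'M[R]_n) (C : forall i j : 'I_q, 'M[R]_(m i j, n))
    (C_diag : forall i, C i i = 0)
    (C_sym : forall i j, eq_mx_rows (C i j) (C j i))
    (C_conn : graph_connected (coupling_edge C))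
    (A_neutral : neutrally_stable A)
    (CA_detect : forall i j, C i j != 0 -> detectable (C i j) A)
    (G : forall i j : 'I_q, 'M[R]_(n, m i j))
    (G_gains : synchronizing_gains A C G) :
  synchronize A C G /\ bounded_solutions A C G.
Proof.
have [A_le0 _] := A_neutral; move: G_gains => [].
have [A_noimag G0 _|A_imag _] := eqVneq (num_imaginary_eigenvalues A) 0%N.
  (* A is stable and G is zero: U is empty and W is the identity. *)
  apply: (@synchronize_and_bounded R n 0 n q m A C 0 1%:M 0 1%:M 0 A) => //.
  - by apply/matrixP => -[].
  - by rewrite mulmx0.
  - by rewrite mulmx0 mulmx1 add0r.
  - by rewrite !mul0mx.
  - by rewrite mul1mx mulmx1.
  - by apply/matrixP => -[].
  - exact: stable_of_no_imaginary_eigenvalue.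
  - by move=> i j; rewrite !mul0mx G0.
case/(_ (elimN eqP A_imag)) => U [W [[V [S [F [VUW VA S_skew F_stable]]]] GE]].
rewrite -[V]vsubmxK in VUW VA.
move: (usubmx V) (dsubmx V) VUW VA => V1 V2 [].
rewrite mul_row_col mul_col_row (scalar_mx_block _ _ 1).
move=> UVWV /eq_block_mx[V1U _ V2U _] VA.
have : col_mx V1 V2 *m A = block_mx S 0 0 F *m col_mx V1 V2.
  by rewrite -VA -!mulmxA mul_row_col UVWV mulmx1.
rewrite mul_col_mx mul_block_col !mul0mx addr0 add0r => /eq_col_mx[V1A V2A].
exact: (synchronize_and_bounded V1U V2U UVWV V1A V2A).
Qed.
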